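(* Let $\Bbbk$ be a field of characteristic zero and let $A$ and $B$ be residually finite-dimensional (RFD) $\Bbbk$-algebras. Let $A*B$ be their free product, and let $\iota_A\colon A_{\natural}\to(A*B)_{\natural}$ and $\iota_B\colon B_{\natural}\to(A*B)_{\natural}$ be the linear maps on cocenters induced by the canonical homomorphisms $A\to A*B$ and $B\to A*B$. Then $\iota_A$ and $\iota_B$ are injective, and $$\operatorname{Rad}_{\mathrm{tr}}(A*B)=\iota_A\bigl(\operatorname{Rad}_{\mathrm{tr}}(A)\bigr)\oplus\iota_B\bigl(\operatorname{Rad}_{\mathrm{tr}}(B)\bigr)$$ as an internal direct sum of subspaces of $(A*B)_{\natural}$.
   Context: An algebra means a nonzero associative unital $\Bbbk$-algebra. A finite-dimensional representation of an algebra $C$ is a unital $\Bbbk$-algebra homomorphism $\rho\colon C\to\operatorname{End}_{\Bbbk}(V)$ with $V$ a nonzero finite-dimensional $\Bbbk$-vector space. An algebra $C$ is residually finite-dimensional (RFD) if for every nonzero $c\in C$ there is a finite-dimensional representation $\rho$ of $C$ with $\rho(c)\neq0$. The cocenter of $C$ is the vector space $C_{\natural}:=C/[C,C]$, where $[C,C]$ is the $\Bbbk$-linear span of all commutators $xy-yx$ with $x,y\in C$; the class of $c\in C$ is denoted $\overline c$. Each finite-dimensional representation $\rho$ induces a linear functional $\operatorname{tr}(-)(\rho)\colon C_{\natural}\to\Bbbk$, $\overline c\mapsto\operatorname{tr}(\rho(c))$. The trace radical of $C$ is $$\operatorname{Rad}_{\mathrm{tr}}(C):=\bigcap_{\rho}\ker\bigl(\operatorname{tr}(-)(\rho)\bigr)\subseteq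 C_{\natural},$$ where $\rho$ ranges over all finite-dimensional representations of $C$. The free product $A*B$ is the coproduct of $A$ and $B$ in the category of unital $\Bbbk$-algebras. *)

(* Defs.v *)
From HB Require Import structures.
From mathcomp Require Import all_boot all_order all_algebra.
From mathcomp Require Import generic_quotient ring_quotient.
From mathcomp Require Import boolp classical_sets.

Set Implicit Arguments.
Unset Strict Implicit.
Unset Printing Implicit Defensive.

Import GRing.Theory passmx.

Local Open Scope classical_set_scope.
Local Open Scope ring_scope.
Local Open Scope quotient_scope.

Section Trace.
Variable k : fieldType.

Definition lftrace (V : vectType k) (f : 'End(V)) : k :=
  \tr (mxof (vbasis {:V}) (vbasis {:V}) f).

Lemma lftrace_is_scalar (V : vectType k) : scalar (@lftrace V).
Proof. by move=> a f g; rewrite /lftrace linearP /= mxtraceD mxtraceZ. Qed.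
HB.instance Definition _ (V : vectType k) :=
  GRing.isLinear.Build k 'End(V) k *%R (@lftrace V) (@lftrace_is_scalar V).

Lemma lftrace_comp (V : vectType k) (f g : 'End(V)) :
  lftrace (f \o g)%VF = lftrace (g \o f)%VF.
Proof.
have b := vbasisP {:V}.
by rewrite /lftrace !(mxof_comp _ _ b) mxtrace_mulC.
Qed.

(* The trace may be computed in any basis. *)
Lemma lftraceE (V : vectType k) (e : (\dim {:V}).-tuple V) (f : 'End(V)) :
  basis_of {:V} e -> lftrace f = \tr (mxof e e f).
Proof.
move=> be; have bv := vbasisP {:V}; rewrite /lftrace.
rewrite -{1}[f]comp_lfun1l -{1}[f]comp_lfun1r !(mxof_comp _ _ be).
rewrite mxtrace_mulC mulmxA -(mxof_comp _ _ bv) comp_lfun1l mxof1 ?mul1mx //.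
exact: basis_free be.
Qed.

End Trace.

Section Representations.
Variable k : fieldType.

Record fdrep (C : algType k) := FDRep {
  fdrep_space : vectType k;
  fdrep_fun :> {linear C -> 'End(fdrep_space)};
  fdrep_neq0 : (0 < \dim {:fdrep_space})%N;
  fdrep1 : fdrep_fun 1 = \1%VF;
  fdrepM : forall x y, fdrep_fun (x * y) = (fdrep_fun x \o fdrep_fun y)%VF
}.

Definition rfd (C : algType k) : Prop :=
  forall c : C, c != 0 -> exists rho : fdrep C, rho c != 0.

End Representations.

Section Cocenter.
Variable k : fieldType.

(* The linear span [C, C] of the commutators. *)
Definition comm_span (C : algType k) : {pred C} := fun c =>
  `[< exists s : seq (k * (C * C)),
        c = \sum_(t <- s) t.1 *: (t.2.1 * t.2.2 - t.2.2 * t.2.1) >].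
Arguments comm_span : clear implicits.

Lemma comm_spanZ (C : algType k) (a : k) (c : C) :
  c \in comm_span C -> a *: c \in comm_span C.
Proof.
move=> /asboolP[s ->]; apply/asboolP.
exists [seq (a * t.1, t.2) | t <- s].
rewrite big_map scaler_sumr; apply: eq_bigr => t _ /=.
by rewrite scalerA.
Qed.

Lemma comm_span_zmod (C : algType k) : zmod_closed (comm_span C).
Proof.
split; first by apply/asboolP; exists [::]; rewrite big_nil.
move=> x y /asboolP[s ->] /(comm_spanZ (-1)) /asboolP[t]; rewrite scaleN1r => ->.
by apply/asboolP; exists (s ++ t); rewrite big_cat.
Qed.
HB.instance Definition _ (C : algType k) :=
  GRing.isZmodClosed.Build C (comm_span C) (@comm_span_zmod C).

Lemma commutator_span (C : algType k) (x y : C) :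
  x * y - y * x \in comm_span C.
Proof.
by apply/asboolP; exists [:: (1, (x, y))]; rewrite big_seq1 scale1r.
Qed.

Definition cocenter (C : algType k) := Quotient.quot (comm_span C).
HB.instance Definition _ (C : algType k) := GRing.Zmodule.on (cocenter C).
HB.instance Definition _ (C : algType k) :=
  EqQuotient.on (cocenter C).

Definition cclass (C : algType k) (c : C) : cocenter C := \pi c.

Lemma cclass_eq (C : algType k) (x y : C) :
  cclass x = cclass y <-> x - y \in comm_span C.
Proof. by rewrite Quotient.idealrBE; split=> [h|/eqP h //]; apply/eqP. Qed.

Lemma cclassK (C : algType k) (u : cocenter C) : cclass (repr u) = u.
Proof. exact: reprK. Qed.

Lemma cclass_repr (C : algType k) (c : C) :
  c - repr (cclass c) \in comm_span C.
Proof. by apply/cclass_eq; rewrite cclassK. Qed.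

Lemma cclassD (C : algType k) (x y : C) :
  cclass (x + y) = cclass x + cclass y.
Proof. exact: Quotient.pi_add. Qed.

(* Scaling, induced maps and induced traces are defined on representatives;
   cocenter_scaleE, cocenter_mapE and cocenter_trE show independence. *)
Definition cocenter_scale (C : algType k) (a : k) (u : cocenter C) :
  cocenter C := cclass (a *: repr u).

Lemma cocenter_scaleE (C : algType k) (a : k) (c : C) :
  cocenter_scale a (cclass c) = cclass (a *: c).
Proof.
apply/esym/cclass_eq; rewrite -scalerBr; apply: comm_spanZ; exact: cclass_repr.
Qed.

Section LmodAxioms.
Variable C : algType k.
Fact cocenter_scaleA a b (u : cocenter C) :
  cocenter_scale a (cocenter_scale b u) = cocenter_scale (a * b) u.
Proof. by rewrite -[u]cclassK !cocenter_scaleE scalerA. Qed.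
Fact cocenter_scale1 : left_id 1 (@cocenter_scale C).
Proof. by move=> u; rewrite -[u]cclassK cocenter_scaleE scale1r. Qed.
Fact cocenter_scaleDr : right_distributive (@cocenter_scale C) +%R.
Proof.
move=> a u v; rewrite -[u]cclassK -[v]cclassK.
by rewrite -cclassD !cocenter_scaleE scalerDr cclassD.
Qed.
Fact cocenter_scaleDl (u : cocenter C) :
  {morph (@cocenter_scale C)^~ u : a b / a + b}.
Proof.
by move=> a b; rewrite -[u]cclassK !cocenter_scaleE scalerDl cclassD.
Qed.
HB.instance Definition _ := GRing.Zmodule_isLmodule.Build k (cocenter C)
  cocenter_scaleA cocenter_scale1 cocenter_scaleDr cocenter_scaleDl.
End LmodAxioms.

Lemma cclass_linear (C : algType k) : linear (@cclass C).
Proof. by move=> a x y; rewrite cclassD -cocenter_scaleE. Qed.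
HB.instance Definition _ (C : algType k) :=
  GRing.isLinear.Build k C (cocenter C) _ (@cclass C) (@cclass_linear C).

Definition cocenter_map (C D : algType k) (f : {lrmorphism C -> D})
  (u : cocenter C) : cocenter D := cclass (f (repr u)).

Lemma cocenter_mapE (C D : algType k) (f : {lrmorphism C -> D}) (c : C) :
  cocenter_map f (cclass c) = cclass (f c).
Proof.
apply/esym/cclass_eq; rewrite -raddfB.
have /asboolP[s ->] := cclass_repr c; apply/asboolP.
exists [seq (t.1, (f t.2.1, f t.2.2)) | t <- s].
rewrite big_map raddf_sum; apply: eq_bigr => t _ /=.
by rewrite linearZ /= rmorphB !rmorphM.
Qed.

Lemma cocenter_map_linear (C D : algType k) (f : {lrmorphism C -> D}) :
  linear (cocenter_map f).
Proof.
move=> a u v; rewrite -[u]cclassK -[v]cclassK.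
by rewrite -linearP !cocenter_mapE -linearP; congr cclass; rewrite linearP.
Qed.
HB.instance Definition _ (C D : algType k) (f : {lrmorphism C -> D}) :=
  GRing.isLinear.Build k (cocenter C) (cocenter D) _ (cocenter_map f)
    (cocenter_map_linear f).

Definition cocenter_tr (C : algType k) (rho : fdrep C) (u : cocenter C) : k :=
  lftrace (rho (repr u)).

Lemma cocenter_trE (C : algType k) (rho : fdrep C) (c : C) :
  cocenter_tr rho (cclass c) = lftrace (rho c).
Proof.
apply/esym/eqP; rewrite -subr_eq0 -!raddfB.
have /asboolP[s ->] := cclass_repr c.
rewrite !raddf_sum big1 // => t _.
rewrite /= (linearZ_LR (fdrep_fun rho)) linearZ_LR (raddfB (fdrep_fun rho)) /=.
rewrite raddfB !fdrepM /=.
by rewrite lftrace_comp subrr mulr0.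
Qed.

Lemma cocenter_tr_is_scalar (C : algType k) (rho : fdrep C) :
  scalar (cocenter_tr rho).
Proof.
move=> a u v; rewrite -[u]cclassK -[v]cclassK.
rewrite -(linearP (@cclass C)) !cocenter_trE (linearP (fdrep_fun rho)).
exact: lftrace_is_scalar.
Qed.
HB.instance Definition _ (C : algType k) (rho : fdrep C) :=
  GRing.isLinear.Build k (cocenter C) k *%R (cocenter_tr rho)
    (cocenter_tr_is_scalar rho).

Definition trace_radical (C : algType k) : set (cocenter C) :=
  [set u | forall rho : fdrep C, cocenter_tr rho u = 0].

End Cocenter.

Arguments comm_span {k} C _.
Arguments trace_radical {k} C _.

Section FreeProduct.
Variable k : fieldType.

Definition is_free_product (A B P : algType k)
    (iA : {lrmorphism A -> P}) (iB : {lrmorphism B -> P}) : Prop :=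
  forall (D : algType k) (f : {lrmorphism A -> D}) (g : {lrmorphism B -> D}),
    (exists h : {lrmorphism P -> D}, h \o iA =1 f /\ h \o iB =1 g) /\
    (forall h h' : {lrmorphism P -> D},
       h \o iA =1 f -> h \o iB =1 g -> h' \o iA =1 f -> h' \o iB =1 g ->
       h =1 h').

End FreeProduct.

Section DirectSum.
Variables (k : fieldType) (V : lmodType k).

Definition subspace (U : set V) : Prop :=
  U 0 /\ forall (a : k) u v, U u -> U v -> U (a *: u + v).

Definition is_direct_sum (W U1 U2 : set V) : Prop :=
  [/\ subspace U1, subspace U2,
      W = [set u + v | u in U1 & v in U2] & U1 `&` U2 = [set 0]].

End DirectSum.

Lemma trace_radical_subspace (k : fieldType) (C : algType k) :
  subspace (trace_radical C).
Proof.
split=> [rho|a u v hu hv rho] /=; first exact: (raddf0 (cocenter_tr rho)).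
by rewrite (cocenter_tr_is_scalar rho) (hu rho) (hv rho) mulr0 addr0.
Qed.

Lemma image_subspace (k : fieldType) (V W : lmodType k)
  (f : {linear V -> W}) (U : set V) : subspace U -> subspace (f @` U).
Proof.
move=> [U0 UP]; split; first by exists 0; rewrite ?raddf0.
move=> a _ _ [u hu <-] [v hv <-]; exists (a *: u + v); first exact: UP.
by rewrite linearP.
Qed.

(* Main.v *)
Require Import Defs.
From HB Require Import structures.
From mathcomp Require Import all_boot all_order all_algebra.
From mathcomp Require Import mxtens zify ring.
From mathcomp Require Import boolp classical_sets.

Import GRing.Theory passmx.

Local Open Scope classical_set_scope.
Local Open Scope ring_scope.

(* Injectivity. A representation g of B on k^n extends to P -> M_n(A), with A
   acting diagonally; composing with the matrix trace into the cocenter of A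
   sends jA a to n times the class of a and jB b to tr(g b) times the class
   of 1.

   Trace radical. Modulo commutators, an element of P is jA a + jB b plus a
   combination of words a_1 b_1 ... a_N b_N. Suppose all its traces vanish and
   let N be the maximal length. Residual finiteness provides representations
   f, g on which finitely many elements of A and B are detected, up to
   scalars, by matrix coefficients vanishing at 1. For linear maps D on A and
   S on B with values in M_N(k), built from such coefficients and hence
   vanishing at 1, there are a space W carrying representations of A and B and
   maps U : k^N -> W, V : W -> k^N with V U = 0, V a U = D a and V b U = S b.
   Then X = U V squares to zero, and after conjugating B by 1 + tX the
   coefficient of t^(2N) in the trace of a word of length N is, up to sign,
   tr(D a_1 S b_1 ... D a_N S b_N). Taking D diagonal and S a weighted cyclic
   shift, this is a sum over cyclic rotations of products of coordinates;
   averaging the words over rotations, which is harmless modulo commutators,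
   shows that the words of length N reduce to shorter ones. Descending to
   N = 0 leaves jA a + jB b, and the representations f (x) 1, 1 (x) g force
   tr(f a) / dim f = - tr(g b) / dim g to be a constant, which is moved from
   one summand to the other. *)

Set Implicit Arguments.
Unset Strict Implicit.
Unset Printing Implicit Defensive.

(** * Representations by matrices *)

Section MatrixRepresentations.
Variable k : fieldType.

(** Unbundled, and the empty size [n = 0] is allowed, unlike in [fdrep]; positivity of [n] is
    assumed separately where it matters. *)
Definition mxrep (C : algType k) n (f : C -> 'M[k]_n) : Prop :=
  [/\ linear f, f 1 = 1%:M & forall x y, f (x * y) = f x *m f y].

Lemma lftrace_mulmxr n (M : 'M[k]_n) :
  lftrace (linfun (mulmxr M) : 'End('rV[k]_n)) = \tr M.
Proof.
pose e := vbasis {:'rV[k]_n}; have be := basis_free (vbasisP {:'rV[k]_n}).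
(* Changes of coordinates between the canonical basis and [e], since [lftrace] is computed in the
   unspecified basis [e]. *)
pose A := lin1_mx (vecof e); pose B := lin1_mx (rVof e).
have BA : B *m A = 1%:M.
  apply/row_matrixP => i; rewrite !rowE mulmx1 mulmxA !mul_rV_lin1 /=.
  by rewrite rVofK ?vbasisP.
rewrite /lftrace; suff -> : mxof e e (linfun (mulmxr M)) = A *m M *m B.
  by rewrite mxtrace_mulC mulmxA BA mul1mx.
apply/row_matrixP => i.
by rewrite !rowE !mulmxA !mul_rV_lin1 /= lfunE /=.
Qed.

Lemma fdrep_of_mxrep (C : algType k) n (f : C -> 'M[k]_n) :
  (0 < n)%N -> mxrep f ->
  exists rho : fdrep C, forall c, lftrace (rho c) = \tr (f c).
Proof.
move=> n_gt0 [flin f1 fM].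
(* [mulmxr] acts on row vectors from the right and so reverses products; the transpose restores
   their order. *)
pose r c : 'End('rV[k]_n) := linfun (mulmxr (f c)^T).
have rlin : linear r.
  move=> a x y; apply/lfunP => v; rewrite add_lfunE scale_lfunE !lfunE /=.
  by rewrite flin raddfD /= linearZ /= mulmxDr -scalemxAr.
pose rL : {linear C -> 'End('rV[k]_n)} :=
  HB.pack r (GRing.isLinear.Build k C 'End('rV[k]_n) *:%R r rlin).
have r1 : rL 1 = \1%VF.
  by apply/lfunP => v; rewrite /= /r f1 trmx1 lfunE /= mulmx1 lfunE.
have rM x y : rL (x * y) = (rL x \o rL y)%VF.
  by apply/lfunP => v; rewrite comp_lfunE /= /r !lfunE /= fM trmx_mul mulmxA.
have dim_gt0 : (0 < \dim {:'rV[k]_n})%N by rewrite dimvf /dim /= mul1n.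
exists (FDRep dim_gt0 r1 rM) => c /=.
by rewrite lftrace_mulmxr mxtrace_tr.
Qed.

Lemma mxrep_of_fdrep (C : algType k) (rho : fdrep C) :
  exists n (f : C -> 'M[k]_n),
    [/\ (0 < n)%N, mxrep f, forall c, lftrace (rho c) = \tr (f c)
      & forall c, f c = 0 -> rho c = 0].
Proof.
pose e := vbasis {:fdrep_space rho}; have be := vbasisP {:fdrep_space rho}.
exists (\dim {:fdrep_space rho}), (fun c => (mxof e e (rho c))^T); split.
- exact: fdrep_neq0.
- split=> [a x y||x y].
  + by rewrite (linearP (fdrep_fun rho)) linearP /= linearP.
  + by rewrite fdrep1 mxof1 ?trmx1 // (basis_free be).
  + by rewrite fdrepM (mxof_comp _ _ be) trmx_mul.
- by move=> c; rewrite mxtrace_tr.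
- move=> c /(congr1 trmx); rewrite trmxK trmx0 => h.
  by apply: (can_inj (mxofK be be)); rewrite h linear0.
Qed.

Lemma trace_radicalP (C : algType k) (c : C) :
  trace_radical C (cclass c) <->
  forall n (f : C -> 'M[k]_n), (0 < n)%N -> mxrep f -> \tr (f c) = 0.
Proof.
split=> [h n f n_gt0 fr | h rho].
  have [rho <-] := fdrep_of_mxrep n_gt0 fr.
  by rewrite -cocenter_trE; exact: h.
have [n [f [n_gt0 fr trf _]]] := mxrep_of_fdrep rho.
by rewrite cocenter_trE trf; exact: h.
Qed.

Lemma rfd_mxrep (C : algType k) : rfd C -> forall c : C, c != 0 ->
  exists n (f : C -> 'M[k]_n), mxrep f /\ f c != 0.
Proof.
move=> Crfd c /Crfd [rho rc]; have [n [f [_ fr _ f0]]] := mxrep_of_fdrep rho.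
by exists n, f; split=> //; apply: contraNneq rc => /f0 ->.
Qed.

End MatrixRepresentations.

(** * Direct sums, tensor products and conjugates of representations *)

Section MatrixRepresentationOperations.
Variables (k : fieldType) (C : algType k).

Lemma mxrep_sum n (f : C -> 'M[k]_n) (fr : mxrep f) I (s : seq I)
    (c : I -> k) (x : I -> C) :
  f (\sum_(i <- s) c i *: x i) = \sum_(i <- s) c i *: f (x i).
Proof.
have [flin _ _] := fr.
elim: s => [|i s IHs]; last by rewrite !big_cons flin IHs.
by rewrite !big_nil; have := flin (-1) 0 0; rewrite scaler0 addr0 scaleN1r addNr.
Qed.

Lemma mxrepD n (f : C -> 'M[k]_n) (fr : mxrep f) x y : f (x + y) = f x + f y.
Proof. by have [flin _ _] := fr; rewrite -[x]scale1r flin !scale1r. Qed.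

Lemma mxrepZ n (f : C -> 'M[k]_n) (fr : mxrep f) a x : f (a *: x) = a *: f x.
Proof.
by have := @mxrep_sum _ _ fr _ [:: tt] (fun=> a) (fun=> x); rewrite !big_seq1.
Qed.

Lemma mxrepB n (f : C -> 'M[k]_n) (fr : mxrep f) x y : f (x - y) = f x - f y.
Proof. by rewrite (mxrepD fr) -scaleN1r (mxrepZ fr) scaleN1r. Qed.

Lemma mxrep_block m n (f : C -> 'M[k]_m) (g : C -> 'M[k]_n) :
  mxrep f -> mxrep g -> mxrep (fun c => block_mx (f c) 0 0 (g c)).
Proof.
move=> [flin f1 fM] [glin g1 gM]; split=> [a x y||x y].
- by rewrite flin glin scale_block_mx add_block_mx !scaler0 !addr0.
- by rewrite f1 g1 -scalar_mx_block.
- by rewrite fM gM mulmx_block !mulmx0 !mul0mx !addr0 !add0r.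
Qed.

Lemma tensmx_linearl m n p q (M : 'M[k]_(m, n)) :
  linear (fun A : 'M[k]_(p, q) => A *t M).
Proof. by move=> a A B; apply/matrixP => i j; rewrite !mxE mulrDl mulrA. Qed.

Lemma tensmx_linearr m n p q (M : 'M[k]_(m, n)) :
  linear (fun A : 'M[k]_(p, q) => M *t A).
Proof. by move=> a A B; apply/matrixP => i j; rewrite !mxE mulrDr mulrCA. Qed.

Lemma tens_mx11 m n : (1%:M : 'M[k]_m) *t (1%:M : 'M[k]_n) = 1%:M.
Proof.
apply/matrixP => i j; case: (mxtens_indexP i) => i1 i2.
case: (mxtens_indexP j) => j1 j2; rewrite tensmxE !mxE.
by rewrite (can_eq (@mxtens_indexK _ _)) xpair_eqE -natrM mulnb.
Qed.

Lemma mxtrace_tens m n (A : 'M[k]_m) (B : 'M[k]_n) :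
  \tr (A *t B) = \tr A * \tr B.
Proof. by rewrite /mxtrace mulr_sum; apply: eq_bigr => i _; rewrite mxE. Qed.

Lemma mxrep_tensl n m (f : C -> 'M[k]_n) :
  mxrep f -> mxrep (fun c => f c *t (1%:M : 'M[k]_m)).
Proof.
move=> [flin f1 fM]; split=> [a x y||x y].
- by rewrite flin; exact: tensmx_linearl.
- by rewrite f1 tens_mx11.
- by rewrite tensmx_mul -fM mulmx1.
Qed.

Lemma mxrep_tensr n m (f : C -> 'M[k]_n) :
  mxrep f -> mxrep (fun c => (1%:M : 'M[k]_m) *t f c).
Proof.
move=> [flin f1 fM]; split=> [a x y||x y].
- by rewrite flin; exact: tensmx_linearr.
- by rewrite f1 tens_mx11.
- by rewrite tensmx_mul -fM mulmx1.
Qed.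

Lemma mxrep_conj n (f : C -> 'M[k]_n) (g h : 'M[k]_n) :
  g *m h = 1%:M -> mxrep f -> mxrep (fun c => g *m f c *m h).
Proof.
move=> gh [flin f1 fM]; have hg : h *m g = 1%:M by apply: mulmx1C.
split=> [a x y||x y].
- by rewrite flin mulmxDr mulmxDl -scalemxAr -scalemxAl.
- by rewrite f1 mulmx1.
- by rewrite fM -!mulmxA (mulmxA h) hg mul1mx.
Qed.

End MatrixRepresentationOperations.

(** * Separating finitely many elements by one vector of a representation *)

Section Separation.
Variables (k : fieldType) (C : algType k).

Definition orbit_mx m (a : 'I_m -> C) n (f : C -> 'M[k]_n) (u : 'cV[k]_n) :
  'M[k]_(m, n) := \matrix_i (f (a i) *m u)^T.

Lemma mul_orbit_mx m (a : 'I_m -> C) n (f : C -> 'M[k]_n) (u : 'cV[k]_n)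
    (c : 'rV[k]_m) : mxrep f ->
  c *m orbit_mx a f u = (f (\sum_i c 0 i *: a i) *m u)^T.
Proof.
move=> fr; rewrite (mxrep_sum fr) mulmx_suml linear_sum mulmx_sum_row.
by apply: eq_bigr => i _; rewrite rowK -scalemxAl linearZ.
Qed.

(* A pair (f, u) whose orbit matrix has maximal rank separates: a relation it
   misses could be removed by passing to a direct sum with another
   representation. *)
Lemma rfd_separating_vector (Crfd : rfd C) m (a : 'I_m -> C) :
  exists n (f : C -> 'M[k]_n) (u : 'cV[k]_n), mxrep f /\
    forall c : 'rV[k]_m, c *m orbit_mx a f u = 0 -> \sum_i c 0 i *: a i = 0.
Proof.
pose P r := `[< exists n (f : C -> 'M[k]_n) (u : 'cV[k]_n),
  mxrep f /\ \rank (orbit_mx a f u) = r >].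
have exP : exists r, P r.
  have [n [f [fr _]]] := rfd_mxrep Crfd (oner_neq0 C).
  by exists (\rank (orbit_mx a f 0)); apply/asboolP; exists n, f, 0.
have ubP r : P r -> (r <= m)%N.
  by move=> /asboolP[n [f [u [_ <-]]]]; exact: rank_leq_row.
case: (ex_maxnP exP ubP) => _ /asboolP[n [f [u [fr <-]]]] maxr.
exists n, f, u; split=> // c c0; apply/eqP/negPn/negP => x0.
have [p [g [gr gx0]]] := rfd_mxrep Crfd x0.
have /existsP[j gxj] : [exists j, col j (g (\sum_i c 0 i *: a i)) != 0].
  apply: contraNT gx0 => /existsPn h; apply/eqP/matrixP => i j.
  by move/eqP/colP/(_ i): (negbNE (h j)); rewrite !mxE.
pose v : 'cV[k]_p := delta_mx j 0.
have hr := mxrep_block fr gr; set h := (fun c => _) in hr.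
have E : orbit_mx a h (col_mx u v) = row_mx (orbit_mx a f u) (orbit_mx a g v).
  apply/row_matrixP => i; rewrite row_row_mx !rowK /h mul_block_col.
  by rewrite !mul0mx addr0 add0r tr_col_mx.
have := maxr _ (asboolT (ex_intro _ _ (ex_intro _ h (ex_intro _ (col_mx u v)
  (conj hr erefl))))).
rewrite leqNgt => /negP; apply; rewrite E.
(* The left kernel of the enlarged orbit matrix lies in that of the old one, and properly so,
   because [c] belongs only to the latter. The rank would then exceed the maximum. *)
have le_ker : (kermx (row_mx (orbit_mx a f u) (orbit_mx a g v))
    <= kermx (orbit_mx a f u))%MS.
  apply/sub_kermxP; have := mulmx_ker (row_mx (orbit_mx a f u) (orbit_mx a g v)).
  by rewrite mul_mx_row -[X in _ = X]row_mx0 => /eq_row_mx[].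
have : (kermx (row_mx (orbit_mx a f u) (orbit_mx a g v))
    < kermx (orbit_mx a f u))%MS.
  rewrite ltmxE le_ker /=; apply/negP => le2.
  have : (c <= kermx (orbit_mx a f u))%MS by apply/sub_kermxP.
  move=> /submx_trans /(_ le2) /sub_kermxP.
  rewrite mul_mx_row -[X in _ = X]row_mx0 => /eq_row_mx[_].
  rewrite (mul_orbit_mx _ _ _ gr) => /(congr1 trmx); rewrite trmxK trmx0.
  by move/eqP; apply/negP; rewrite -colE.
move/rank_ltmx; rewrite !mxrank_ker.
by move=> lt; rewrite -(ltn_sub2lE _ (rank_leq_row _)).
Qed.

(* Coordinates modulo scalars on s, in a family e which need not be
   independent. *)
Lemma rfd_coordinates (Crfd : rfd C) (s : seq C) :
  exists m (e : 'I_m -> C) n (f : C -> 'M[k]_n) (u : 'cV[k]_n)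
      (phi : 'M[k]_(m, n)) (eps : 'rV[k]_n),
    [/\ mxrep f, phi *m u = 0, eps *m u = 1%:M &
      forall x, x \in s ->
        exists l, x - \sum_j (phi *m f x *m u) j 0 *: e j = l%:A].
Proof.
(* With 1 put in front of [s], the elements [x - l%:A] are combinations of the family [e], and a
   separating vector cannot be zero. *)
pose e (i : 'I_(size s).+1) := nth 0 (1 :: s) i.
have [n [f [u [fr sep]]]] := rfd_separating_vector Crfd e.
have [_ f1 _] := fr.
have sum_delta i : \sum_j (delta_mx 0 i : 'rV[k]_(size s).+1) 0 j *: e j = e i.
  rewrite (bigD1 i) //= mxE !eqxx scale1r big1 ?addr0 // => j ji.
  by rewrite mxE eqxx (negbTE ji) scale0r.
have u0 : u != 0.
  apply/eqP => u0; have := sep (delta_mx 0 ord0).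
  rewrite mul_orbit_mx // sum_delta u0 mulmx0 trmx0 => /(_ erefl) /eqP.
  by rewrite /e /= oner_eq0.
have [i ui] : exists i, u i 0 != 0.
  apply/existsP; apply: contraNT u0 => /existsPn h; apply/eqP/colP => i.
  by rewrite mxE; apply/eqP/negPn.
pose eps : 'rV[k]_n := (u i 0)^-1 *: delta_mx 0 i.
have epsu : eps *m u = 1%:M.
  by rewrite -scalemxAl -rowE; apply/rowP => j; rewrite ord1 !mxE mulVf.
pose R := orbit_mx e f u.
(* The matrix [1 - u eps] is the projection that kills [u], so it subtracts from [f x *m u] the
   multiple [l] of [u]; the pseudo-inverse of the orbit matrix then recovers coefficients in [e]. *)
exists (size s).+1, e, n, f, u, ((pinvmx R)^T *m (1%:M - u *m eps)), eps.
split=> //; first by rewrite -mulmxA mulmxBl mul1mx -mulmxA epsu mulmx1 subrr mulmx0.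
move=> x xs; exists ((eps *m f x *m u) 0 0); set l := _ 0 0.
have [j ej] : exists j, x = e j.
  have lt : ((index x s).+1 < (size s).+1)%N by rewrite ltnS index_mem.
  by exists (Ordinal lt); rewrite /e /= nth_index.
pose d : 'rV[k]_(size s).+1 := delta_mx 0 j - l *: delta_mx 0 ord0.
have sum_d : \sum_i d 0 i *: e i = x - l%:A.
  rewrite (eq_bigr (fun i => (delta_mx 0 j : 'rV[k]_(size s).+1) 0 i *: e i -
    l *: ((delta_mx 0 ord0 : 'rV[k]_(size s).+1) 0 i *: e i))); last first.
    by move=> i' _; rewrite !mxE scalerBl scalerA.
  by rewrite sumrB -scaler_sumr !sum_delta -ej.
(* The recovered coefficients [c] may differ from [d] when [e] is dependent, but [c - d] kills the
   orbit matrix, so by separation both give the same element. *)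
pose c := d *m R *m pinvmx R.
have cR : (c - d) *m R = 0 by rewrite mulmxBl mulmxKpV ?submxMl ?subrr.
have sum_c : \sum_i c 0 i *: e i = x - l%:A.
  apply/eqP; rewrite -subr_eq0 -sum_d -sumrB -[X in _ == X](sep _ cR); apply/eqP.
  by apply: eq_bigr => i' _; rewrite [(c - d) _ _]mxE [(- d) _ _]mxE scalerBl.
suff cE i' : ((pinvmx R)^T *m (1%:M - u *m eps) *m f x *m u) i' 0 = c 0 i'.
  under eq_bigr => i' _ do rewrite cE.
  by rewrite sum_c opprB addrCA subrr addr0.
rewrite -[c]trmxK [RHS]mxE /c mul_orbit_mx // sum_d (mxrepB fr) (mxrepZ fr) f1.
rewrite [in RHS]trmx_mul trmxK; congr (fun_of_matrix _ _ _).
rewrite -!mulmxA; congr (_ *m _); rewrite mulmxBl mul1mx mulmxBl; congr (_ - _).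
rewrite -scalemxAl mul1mx -mulmxA -mul_mx_scalar; congr (_ *m _).
by rewrite mulmxA [LHS]mx11_scalar.
Qed.

End Separation.

(* 'M[A]_n.+1 carries scalars from A in the library; the alias carries those
   from k. *)
Definition mxalg (k : fieldType) (A : algType k) (n : nat) := 'M[A]_n.+1.

(** * Matrices over an algebra and their trace in the cocenter *)

Section MatrixAlgebra.
Variables (k : fieldType) (A : algType k) (n : nat).
Local Notation M := (mxalg A n).

HB.instance Definition _ := GRing.NzRing.copy M 'M[A]_n.+1.

Definition mxalg_scale (a : k) (X : M) : M := map_mx ( *:%R a) X.

Fact mxalg_scaleA a b X : mxalg_scale a (mxalg_scale b X) = mxalg_scale (a * b) X.
Proof. by apply/matrixP => i j; rewrite !mxE scalerA. Qed.
Fact mxalg_scale1 : left_id 1 mxalg_scale.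
Proof. by move=> X; apply/matrixP => i j; rewrite !mxE scale1r. Qed.
Fact mxalg_scaleDr : right_distributive mxalg_scale +%R.
Proof. by move=> a X Y; apply/matrixP => i j; rewrite !mxE scalerDr. Qed.
Fact mxalg_scaleDl X : {morph mxalg_scale^~ X : a b / a + b}.
Proof. by move=> a b; apply/matrixP => i j; rewrite !mxE scalerDl. Qed.
HB.instance Definition _ := GRing.Zmodule_isLmodule.Build k M
  mxalg_scaleA mxalg_scale1 mxalg_scaleDr mxalg_scaleDl.

Fact mxalg_scaleAl (a : k) (X Y : M) : a *: (X * Y) = (a *: X) * Y.
Proof.
apply/matrixP => i j; rewrite !mxE scaler_sumr; apply: eq_bigr => l _.
by rewrite !mxE scalerAl.
Qed.
HB.instance Definition _ := GRing.Lmodule_isLalgebra.Build k M mxalg_scaleAl.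

Fact mxalg_scaleAr (a : k) (X Y : M) : a *: (X * Y) = X * (a *: Y).
Proof.
apply/matrixP => i j; rewrite !mxE scaler_sumr; apply: eq_bigr => l _.
by rewrite !mxE scalerAr.
Qed.
HB.instance Definition _ := GRing.Lalgebra_isAlgebra.Build k M mxalg_scaleAr.

Definition mxalg_diag (a : A) : M := a%:M.

Fact mxalg_diag_linear : linear mxalg_diag.
Proof.
by move=> c a b; apply/matrixP => i j; rewrite !mxE mulrnDl scalerMnr.
Qed.
HB.instance Definition _ :=
  GRing.isLinear.Build k A M _ mxalg_diag mxalg_diag_linear.
Fact mxalg_diag_monoid : monoid_morphism mxalg_diag.
Proof. by split=> // x y; rewrite /mxalg_diag scalar_mxM. Qed.
HB.instance Definition _ :=
  GRing.isMonoidMorphism.Build A M mxalg_diag mxalg_diag_monoid.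

Definition mxalg_const (X : 'M[k]_n.+1) : M := map_mx (in_alg A) X.

Fact mxalg_const_linear : linear mxalg_const.
Proof.
by move=> c X Y; apply/matrixP => i j; rewrite !mxE /= scalerDl scalerA.
Qed.
HB.instance Definition _ :=
  GRing.isLinear.Build k 'M[k]_n.+1 M _ mxalg_const mxalg_const_linear.
Fact mxalg_const_monoid : monoid_morphism mxalg_const.
Proof. by split=> [|X Y]; [exact: map_mx1 | exact: map_mxM]. Qed.
HB.instance Definition _ :=
  GRing.isMonoidMorphism.Build 'M[k]_n.+1 M mxalg_const mxalg_const_monoid.

(** This is the Hattori-Stallings trace: over a noncommutative [A] the sum of the diagonal entries
    is cyclic only modulo commutators. *)
Definition mxalg_tr (X : M) : cocenter A := cclass (\sum_i X i i).

Lemma mxalg_tr_linear : linear mxalg_tr.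
Proof.
move=> c X Y; rewrite /mxalg_tr -linearP; congr cclass.
by rewrite scaler_sumr -big_split; apply: eq_bigr => i _; rewrite !mxE.
Qed.
HB.instance Definition _ :=
  GRing.isLinear.Build k M (cocenter A) _ mxalg_tr mxalg_tr_linear.

Lemma mxalg_trM (X Y : M) : mxalg_tr (X * Y) = mxalg_tr (Y * X).
Proof.
apply/cclass_eq.
have -> : \sum_i (X * Y) i i = \sum_i \sum_j X i j * Y j i.
  by apply: eq_bigr => i _; rewrite mxE.
have -> : \sum_i (Y * X) i i = \sum_i \sum_j Y j i * X i j.
  by rewrite exchange_big; apply: eq_bigr => i _; rewrite mxE.
rewrite -sumrB rpred_sum // => i _; rewrite -sumrB rpred_sum // => j _.
exact: commutator_span.
Qed.

Lemma mxalg_tr_diag a : mxalg_tr (mxalg_diag a) = n.+1%:R *: cclass a.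
Proof.
rewrite /mxalg_tr (eq_bigr (fun=> a)); last by move=> i _; rewrite mxE eqxx.
by rewrite sumr_const card_ord scaler_nat raddfMn.
Qed.

Lemma mxalg_tr_const X : mxalg_tr (mxalg_const X) = \tr X *: cclass 1.
Proof.
rewrite /mxalg_tr (eq_bigr (fun i => X i i *: 1)).
  by rewrite -scaler_suml linearZ.
by move=> i _; rewrite mxE.
Qed.

End MatrixAlgebra.

(** * Words in a free product and consequences of the universal property *)

Section FreeProduct.
Variables (k : fieldType) (A B P : algType k).
Variables (jA : {lrmorphism A -> P}) (jB : {lrmorphism B -> P}).

Lemma lrmorphism_of (C D : algType k) (f : C -> D) : linear f -> f 1 = 1 ->
  {morph f : x y / x * y} -> {h : {lrmorphism C -> D} | h =1 f}.
Proof.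
move=> flin f1 fM.
pose fL := GRing.isLinear.Build k C D *:%R f flin.
pose fR := GRing.isMonoidMorphism.Build C D f (f1, fM).
by exists (HB.pack_for {lrmorphism C -> D} f fL fR).
Qed.

Lemma mxrep_comp (C D : algType k) (j : {lrmorphism C -> D}) n (h : D -> 'M[k]_n) :
  mxrep h -> mxrep (h \o j).
Proof.
move=> [hlin h1 hM]; split=> [a x y||x y] /=.
- by rewrite linearP hlin.
- by rewrite rmorph1.
- by rewrite rmorphM hM.
Qed.

Hypothesis fp : is_free_product jA jB.

Lemma free_product_mxrep n (f : A -> 'M[k]_n) (g : B -> 'M[k]_n) :
  (0 < n)%N -> mxrep f -> mxrep g ->
  exists h : P -> 'M[k]_n, [/\ mxrep h, forall a, h (jA a) = f a
    & forall b, h (jB b) = g b].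
Proof.
case: n f g => // n f g _ [flin f1 fM] [glin g1 gM].
have [f' f'E] := @lrmorphism_of A 'M[k]_n.+1 f flin f1 fM.
have [g' g'E] := @lrmorphism_of B 'M[k]_n.+1 g glin g1 gM.
have [[h [hA hB]] _] := fp f' g'.
exists h; split=> [|a|b]; last 2 first.
- by rewrite -f'E -hA.
- by rewrite -g'E -hB.
by split=> [|| x y]; [exact: linearP | exact: rmorph1 | exact: rmorphM].
Qed.

Definition word (s : seq (A * B)) : P := \prod_(t <- s) (jA t.1 * jB t.2).

(** Sums without coefficients suffice, because a scalar [a] can be absorbed as the extra pair
    [(a%:A, 1)]. *)
Definition word_span : {pred P} := fun c =>
  `[< exists ss : seq (seq (A * B)), c = \sum_(s <- ss) word s >].

Lemma word_cat s1 s2 : word (s1 ++ s2) = word s1 * word s2.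
Proof. by rewrite /word big_cat. Qed.

Lemma word_cons t s : word (t :: s) = jA t.1 * jB t.2 * word s.
Proof. by rewrite /word big_cons. Qed.

Lemma word_spanP s : word s \in word_span.
Proof. by apply/asboolP; exists [:: s]; rewrite big_seq1. Qed.

Lemma word_span_closed : GRing.subsemialg_closed word_span.
Proof.
have addP : {in word_span &, forall x y, x + y \in word_span}.
  move=> _ _ /asboolP[s1 ->] /asboolP[s2 ->]; apply/asboolP.
  by exists (s1 ++ s2); rewrite big_cat.
have zP : 0 \in word_span by apply/asboolP; exists [::]; rewrite big_nil.
have sumP I (r : seq I) (F : I -> P) :
    (forall i, F i \in word_span) -> \sum_(i <- r) F i \in word_span.
  by move=> FP; elim/big_ind: _.
split=> //.
- by apply/asboolP; exists [:: [::]]; rewrite big_seq1 /word big_nil.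
- move=> a _ /asboolP[ss ->]; rewrite scaler_sumr sumP // => s.
  suff -> : a *: word s = word ((a%:A, 1) :: s) by exact: word_spanP.
  by rewrite word_cons /= linearZ !rmorph1 mulr1 mulr_algl.
- move=> _ _ /asboolP[s1 ->] /asboolP[s2 ->]; rewrite mulr_suml.
  apply: (sumP) => s; rewrite mulr_sumr; apply: (sumP) => s'.
  by rewrite -word_cat word_spanP.
Qed.

Definition word_alg := {c : P | c \in word_span}.
HB.instance Definition _ := SubChoice.on word_alg.
HB.instance Definition _ :=
  GRing.SubChoice_isSubAlgebra.Build k P _ word_alg word_span_closed.

(** The sums of words form a subalgebra containing both images. The universal property maps [P] into
    it, and by uniqueness the composite with the inclusion is the identity of [P]. *)
Lemma free_product_span c : exists ss, c = \sum_(s <- ss) word s.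
Proof.
have WA a : jA a \in word_span.
  by have := word_spanP [:: (a, 1)]; rewrite /word big_seq1 rmorph1 mulr1.
have WB b : jB b \in word_span.
  by have := word_spanP [:: (1, b)]; rewrite /word big_seq1 rmorph1 mul1r.
pose iA a : word_alg := Sub (jA a) (WA a).
pose iB b : word_alg := Sub (jB b) (WB b).
have [f fE] : {f : {lrmorphism A -> word_alg} | f =1 iA}.
  by apply: lrmorphism_of => [x a b||a b]; apply: val_inj;
    rewrite /= ?linearP ?rmorph1 ?rmorphM.
have [g gE] : {g : {lrmorphism B -> word_alg} | g =1 iB}.
  by apply: lrmorphism_of => [x a b||a b]; apply: val_inj;
    rewrite /= ?linearP ?rmorph1 ?rmorphM.
have [[h [hA hB]] _] := fp f g.
have [h' h'E] : {h' : {lrmorphism P -> P} | h' =1 fun x => val (h x)}.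
  by apply: lrmorphism_of => [a x y||x y]; rewrite ?linearP ?rmorph1 ?rmorphM.
have [_ /(_ h' idfun)] := fp jA jB.
suff E : h' c = c -> exists ss, c = \sum_(s <- ss) word s.
  move=> uniq; apply: E; apply: uniq => [a|b|//|//] /=.
  - by rewrite h'E; have /= -> := hA a; rewrite fE.
  - by rewrite h'E; have /= -> := hB b; rewrite gE.
by rewrite h'E => <-; apply/asboolP; exact: (valP (h c)).
Qed.

(** [T] is [mxalg_tr] after the homomorphism to matrices over [A] that is diagonal on [A] and given
    by the constant matrices [g b] on [B]. *)
Lemma free_product_trace n (g : B -> 'M[k]_n) : (0 < n)%N -> mxrep g ->
  exists T : {linear P -> cocenter A},
    [/\ forall x, x \in comm_span P -> T x = 0,
        forall a, T (jA a) = n%:R *: cclass a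
      & forall b, T (jB b) = \tr (g b) *: cclass 1].
Proof.
case: n g => // n g _ [glin g1 gM].
have [g' g'E] := @lrmorphism_of B 'M[k]_n.+1 g glin g1 gM.
have [[h [hA hB]] _] := fp (@mxalg_diag k A n) (@mxalg_const k A n \o g').
exists (@mxalg_tr k A n \o h); split=> [_ /asboolP[s ->]|a|b] /=.
- rewrite linear_sum linear_sum big1 // => t _.
  by rewrite !linearZ !linearB /= !rmorphM mxalg_trM subrr scaler0.
- by have /= -> := hA a; rewrite mxalg_tr_diag.
- by have /= -> := hB b; rewrite mxalg_tr_const g'E.
Qed.

Lemma free_product_swap : is_free_product jB jA.
Proof.
move=> D f g; have [[h [hA hB]] uniq] := fp g f.
by split=> [|h1 h2 *]; [exists h | exact: uniq].
Qed.

End FreeProduct.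

(** * Rotation of products modulo commutators *)

Section CyclicWords.
Variables (k : fieldType) (P : algType k).

Lemma cclassM (x y : P) : cclass (x * y) = cclass (y * x).
Proof. exact/cclass_eq/commutator_span. Qed.

(** Rotation by one step moves the last factor to the front, which [cclassM] allows; the general
    case follows by induction on the representative of [r]. *)
Lemma cclass_prod_rot n (h : 'I_n.+1 -> P) r :
  cclass (\prod_i h (i + r)) = cclass (\prod_i h i).
Proof.
have inZpS j : inZp j.+1 = inZp 1 + inZp j :> 'I_n.+1.
  by apply: val_inj; rewrite /= modnDm add1n.
rewrite -(valZpK r); elim: (val r) h => [|j IHj] h.
  congr cclass; apply: eq_bigr => i _; congr h; apply: val_inj.
  by rewrite /= mod0n addn0 modn_small.
rewrite inZpS -[RHS](IHj h).
transitivity (cclass (\prod_i h (inZp 1 + i + inZp j))).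
  by congr cclass; apply: eq_bigr => i _; rewrite addrCA addrA.
rewrite big_ord_recr big_ord_recl /= cclassM; congr cclass; congr (_ * _).
  by congr (h (_ + _)); apply: val_inj; rewrite /= modnDml add1n modnn.
apply: eq_bigr => i _; congr (h (_ + _)); apply: val_inj.
by rewrite /= modnDml /bump add1n modn_small // ltnS.
Qed.

(** Multiplied by [n.+1], each class is the sum of the classes of its rotations. Expanding these,
    the hypothesis says that the total coefficient of each product of the [w (I i)] is zero; in
    characteristic zero [n.+1] can be cancelled. *)
Lemma cyclic_average_eq0 (k0 : [pchar k] =i pred0) n (Q : finType) (w : Q -> P)
    (S : Type) (ss : seq S) (c : S -> 'I_n.+1 -> Q -> k) :
  (forall I : {ffun 'I_n.+1 -> Q},
     \sum_(s <- ss) \sum_r \prod_i c s (i + r) (I i) = 0) ->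
  \sum_(s <- ss) cclass (\prod_i \sum_q c s i q *: w q) = 0.
Proof.
move=> c0; set X := LHS.
have n0 : n.+1%:R != 0 :> k by rewrite (pcharf0P k).1.
apply: (scalerI n0); rewrite scaler0 /X scaler_sumr.
rewrite (eq_bigr (fun s => \sum_(I : {ffun 'I_n.+1 -> Q})
    \sum_r (\prod_i c s (i + r) (I i)) *: cclass (\prod_i w (I i)))); last first.
  move=> s _; rewrite exchange_big /=; set u := cclass _.
  have -> : n.+1%:R *: u = \sum_(r < n.+1) u.
    by rewrite sumr_const card_ord scaler_nat.
  apply: eq_bigr => r _; rewrite /u -(cclass_prod_rot _ r) bigA_distr_bigA linear_sum.
  by apply: eq_bigr => I _; rewrite scaler_prod linearZ.
rewrite exchange_big big1 // => I _.
under eq_bigr do rewrite -scaler_suml.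
by rewrite -scaler_suml c0 scale0r.
Qed.
End CyclicWords.

(** * Classes of short words and reduction of length *)

Section ShortWords.
Variables (k : fieldType) (A B P : algType k).
Variables (jA : {lrmorphism A -> P}) (jB : {lrmorphism B -> P}).
Local Notation word := (@word k A B P jA jB).

(** The terms from [A] and [B] are listed apart from the words: as words they have length one, while
    the descent ends at [m = 0]. *)
Definition short_class m (u : cocenter P) : Prop :=
  exists a b (ss : seq (seq (A * B))), all (fun s => size s <= m)%N ss /\
    u = cclass (jA a) + cclass (jB b) + \sum_(s <- ss) cclass (word s).

Lemma short_classD m u v :
  short_class m u -> short_class m v -> short_class m (u + v).
Proof.
move=> [a [b [s [hs ->]]]] [a' [b' [s' [hs' ->]]]].
exists (a + a'), (b + b'), (s ++ s'); rewrite all_cat hs hs'; split=> //.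
by rewrite !raddfD big_cat /= addrACA; congr (_ + _); rewrite addrACA.
Qed.

Lemma short_class_jA m a : short_class m (cclass (jA a)).
Proof.
by exists a, 0, [::]; rewrite big_nil !raddf0 !addr0.
Qed.

Lemma short_class_jB m b : short_class m (cclass (jB b)).
Proof.
by exists 0, b, [::]; rewrite big_nil !raddf0 addr0 add0r.
Qed.

Lemma short_class_word m s : (size s <= m)%N -> short_class m (cclass (word s)).
Proof.
by move=> sm; exists 0, 0, [:: s]; rewrite /= sm big_seq1 !raddf0 !add0r.
Qed.

Lemma short_class_sum m I (r : seq I) (Q : pred I) (F : I -> cocenter P) :
  (forall i, Q i -> short_class m (F i)) ->
  short_class m (\sum_(i <- r | Q i) F i).
Proof.
move=> FP; elim/big_ind: _ => //; last exact: short_classD.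
by rewrite -(raddf0 (@cclass k P)) -(raddf0 jA); exact: short_class_jA.
Qed.

(** After a rotation the pair with the scalar comes first. What remains of it, [jB (l *: b)], is
    cyclically adjacent to the last letter from [B] and merges with it, or stands alone if there is
    no other pair. *)
Lemma short_class_scalarA m l b s1 s2 : (size s1 + size s2 = m)%N ->
  short_class m (cclass (word (s1 ++ (l%:A, b) :: s2))).
Proof.
move=> sz; rewrite word_cat cclassM -word_cat /= word_cons /=.
have -> : jA l%:A * jB b = jB (l *: b).
  by rewrite !linearZ /= rmorph1 mulr_algl.
have {sz} : size (s2 ++ s1) = m by rewrite size_cat addnC.
case: (lastP (s2 ++ s1)) => [|s [a' b'] <-].
  by rewrite /word big_nil mulr1 => _; exact: short_class_jB.
rewrite cclassM -cats1 word_cat word_cons {2}/word big_nil /= mulr1 -!mulrA -rmorphM.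
have -> : word s * (jA a' * jB (b' * (l *: b))) =
    word (rcons s (a', b' * (l *: b))).
  by rewrite -cats1 word_cat word_cons {3}/word big_nil mulr1.
by apply: short_class_word; rewrite cats1 !size_rcons.
Qed.

Lemma short_class_scalarB m a l s1 s2 : (size s1 + size s2 = m)%N ->
  short_class m (cclass (word (s1 ++ (a, l%:A) :: s2))).
Proof.
move=> sz; rewrite word_cat cclassM -word_cat /= word_cons /=.
have -> : jA a * jB l%:A = jA (l *: a).
  by rewrite !linearZ /= rmorph1 mulr_algr.
have {sz} : size (s2 ++ s1) = m by rewrite size_cat addnC.
case: (s2 ++ s1) => [|[a' b'] s <-].
  by rewrite /word big_nil mulr1 => _; exact: short_class_jA.
rewrite word_cons !mulrA -rmorphM /=.
have -> : jA (l *: a * a') * jB b' * word s = word ((l *: a * a', b') :: s).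
  by rewrite word_cons.
exact: short_class_word.
Qed.

(** Pairs are replaced one at a time, [s1] collecting those already treated. Each replacement costs
    two words with a scalar letter, one for each component of the pair, and these are short. *)
Lemma short_class_approx m (p : A * B -> A * B) s1 s2 :
  (forall t, t \in s2 -> (exists l, t.1 - (p t).1 = l%:A) /\
    (exists l, t.2 - (p t).2 = l%:A)) ->
  (size s1 + size s2 = m.+1)%N ->
  short_class m (cclass (word (s1 ++ s2)) - cclass (word (s1 ++ map p s2))).
Proof.
elim: s2 s1 => [|[a b] s2 IHs] s1 hp sz.
  by rewrite subrr -(raddf0 (@cclass k P)) -(raddf0 jA); exact: short_class_jA.
have [[l hl] [l' hl']] := hp (a, b) (mem_head _ _).
case E: (p (a, b)) hl hl' => [a' b'] /= hl hl'.
have -> : cclass (word (s1 ++ (a, b) :: s2)) -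
    cclass (word (s1 ++ p (a, b) :: map p s2)) =
    cclass (word (s1 ++ (l%:A, b) :: s2)) +
    cclass (word (s1 ++ (a', l'%:A) :: s2)) +
    (cclass (word (rcons s1 (a', b') ++ s2)) -
     cclass (word (rcons s1 (a', b') ++ map p s2))).
  rewrite -hl -hl' !cat_rcons E addrA; congr (_ - _).
  rewrite -!raddfD; congr cclass; rewrite !word_cat -!mulrDr; congr (_ * _).
  rewrite !word_cons /= -!mulrDl; congr (_ * _).
  by rewrite !raddfB /= mulrBl mulrBr addrA !subrK.
move: sz; rewrite /= addnS => -[sz].
apply: short_classD; first apply: short_classD.
- exact: short_class_scalarA.
- exact: short_class_scalarB.
- apply: IHs; last by rewrite size_rcons addSn sz.
  by move=> t ts; apply: hp; rewrite inE ts orbT.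
Qed.

End ShortWords.

(** * Top coefficients of polynomials and polynomial matrices *)

Section TopCoefficient.
Variable k : fieldType.

Lemma polyM_top (p q : {poly k}) i j :
  (size p <= i.+1)%N -> (size q <= j.+1)%N ->
  (size (p * q)%R <= (i + j).+1)%N /\ (p * q)`_(i + j) = p`_i * q`_j.
Proof.
move=> sp sq; split.
  by have := size_polyMleq p q; lia.
have ii : (i < (i + j).+1)%N by rewrite ltnS leq_addr.
rewrite coefM (bigD1 (Ordinal ii)) //= addKn big1 ?addr0 // => l.
rewrite -val_eqE /= => li.
have [lt|le] := ltnP i l; first by rewrite nth_default ?mul0r // (leq_trans sp).
by rewrite [X in _ * X]nth_default ?mulr0 // (leq_trans sq) //; lia.
Qed.

(** In characteristic zero the integers below [size p] are distinct, and already too many roots for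
    a nonzero [p]. *)
Lemma poly_all_roots (k0 : [pchar k] =i pred0) (p : {poly k}) :
  (forall t, p.[t] = 0) -> p = 0.
Proof.
move=> p0; apply/eqP/negPn/negP => pn0.
have := max_poly_roots (rs := [seq i%:R | i <- iota 0 (size p)]) pn0.
rewrite size_map size_iota ltnn => h; suff: false by [].
apply: h; first by apply/allP => t _; apply/eqP.
rewrite map_inj_uniq ?iota_uniq // => i j; wlog: i j / (i <= j)%N.
  by move=> w; case: (leqP i j) => [/w//|/ltnW/w h /esym/h].
move=> ij /esym/eqP; rewrite -subr_eq0 -natrB // (pcharf0P k).1 // subn_eq0 => ji.
by apply/eqP; rewrite eqn_leq ij.
Qed.

(** Here [d] only bounds the degrees and [C] may vanish, so that the notion is stable under
    products. *)
Definition topmx m n (M : 'M[{poly k}]_(m, n)) d (C : 'M[k]_(m, n)) : Prop :=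
  forall i j, (size (M i j) <= d.+1)%N /\ (M i j)`_d = C i j.

Lemma topmx_mul m n p (M : 'M[{poly k}]_(m, n)) (N : 'M[{poly k}]_(n, p)) d e C D :
  topmx M d C -> topmx N e D -> topmx (M *m N) (d + e) (C *m D).
Proof.
move=> MC ND i j; rewrite !mxE; split.
  apply: leq_trans (size_sum _ _ _) _; apply/bigmax_leqP => l _.
  by have [] := polyM_top (MC i l).1 (ND l j).1.
rewrite coef_sum; apply: eq_bigr => l _.
by rewrite (polyM_top (MC i l).1 (ND l j).1).2 (MC i l).2 (ND l j).2.
Qed.

Lemma topmx_tr n (M : 'M[{poly k}]_n) d C : topmx M d C ->
  (size (\tr M)%R <= d.+1)%N /\ (\tr M)`_d = \tr C.
Proof.
move=> MC; split.
  by apply: leq_trans (size_sum _ _ _) _; apply/bigmax_leqP => l _; have [] := MC l l.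
by rewrite coef_sum; apply: eq_bigr => l _; have [] := MC l l.
Qed.

End TopCoefficient.

(** * Traces under conjugation by [1 + tX] *)

Section Pencil.
Variables (k : fieldType) (A B P : algType k).
Variables (jA : {lrmorphism A -> P}) (jB : {lrmorphism B -> P}).
Hypothesis k0 : [pchar k] =i pred0.
Hypothesis fp : is_free_product jA jB.
Local Notation word := (@word k A B P jA jB).

Variables (d : nat) (f : A -> 'M[k]_d) (g : B -> 'M[k]_d) (X : 'M[k]_d).
Hypotheses (d_gt0 : (0 < d)%N) (fr : mxrep f) (gr : mxrep g) (XX : X *m X = 0).

(* The entries of (1 + tX) g(b) (1 - tX) as polynomials in t. *)
Let gX b : 'M[{poly k}]_d := \matrix_(i, j)
  Poly [:: g b i j; (X *m g b - g b *m X) i j; (- (X *m g b *m X)) i j].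

Let wordX s : 'M[{poly k}]_d :=
  \prod_(t <- s) (map_mx polyC (f t.1) *m gX t.2).

Let unitX t : (1%:M + t *: X) *m (1%:M - t *: X) = 1%:M.
Proof.
rewrite mulmxDl !mul1mx mulmxBr mulmx1 -scalemxAl -scalemxAr XX !scaler0.
by rewrite subr0 subrK.
Qed.

Let gX_eval t b :
  map_mx (horner_eval t) (gX b) = (1%:M + t *: X) *m g b *m (1%:M - t *: X).
Proof.
apply/matrixP => i j; rewrite mxE /horner_eval mxE horner_Poly /=.
rewrite mulmxDl mul1mx mulmxBr mulmx1 mulmxDl -!scalemxAl -!scalemxAr.
set Y := X *m g b; set Z := g b *m X; set W := Y *m X.
by rewrite !mxE; ring.
Qed.

Let gX_top b : topmx (gX b) 2 (- (X *m g b *m X)).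
Proof. by move=> i j; rewrite mxE coef_Poly size_Poly. Qed.

Let wordX_top s : topmx (wordX s) (2 * size s)
  (\prod_(t <- s) (f t.1 *m - (X *m g t.2 *m X))).
Proof.
rewrite /wordX; elim: s => [|t s IHs].
  rewrite !big_nil => i j; rewrite !mxE.
  by case: (i == j); rewrite ?coef1 ?coef0 ?size_poly1 ?size_poly0.
rewrite !big_cons mulnS; apply: topmx_mul IHs; rewrite -[2%N]add0n.
by apply: topmx_mul (gX_top _) => i j; rewrite mxE coefC size_polyC leq_b1.
Qed.

Let h_word h t s : mxrep h -> (forall a, h (jA a) = f a) ->
  (forall b, h (jB b) = (1%:M + t *: X) *m g b *m (1%:M - t *: X)) ->
  h (word s) = map_mx (horner_eval t) (wordX s).
Proof.
move=> [_ h1 hM] hA hB; rewrite /word /wordX; elim: s => [|[a b] s IHs].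
  by rewrite !big_nil h1 map_mx1.
rewrite !big_cons map_mxM hM IHs /= map_mxM hM hA hB gX_eval; congr (_ *m _ *m _).
by apply/matrixP => i j; rewrite !mxE /= /horner_eval hornerC.
Qed.

Lemma trace_radical_pencil n a b (ss : seq (seq (A * B))) :
  all (fun s => size s <= n.+1)%N ss ->
  trace_radical P (cclass (jA a + jB b + \sum_(s <- ss) word s)) ->
  \sum_(s <- ss | size s == n.+1)
     \tr (\prod_(t <- s) (f t.1 *m (X *m g t.2 *m X))) = 0.
Proof.
move=> hss /trace_radicalP tr0.
(* The trace of the given element under the conjugated representation, as a polynomial in [t];
   conjugation leaves the trace of [g b] constant. *)
pose q := (\tr (f a) + \tr (g b))%:P + \sum_(s <- ss) \tr (wordX s).
have q0 : q = 0.
  apply: poly_all_roots => // t.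
  have [h [hr hA hB]] := free_product_mxrep fp d_gt0 fr (mxrep_conj (unitX t) gr).
  have trB : \tr ((1%:M + t *: X) *m g b *m (1%:M - t *: X)) = \tr (g b).
    by rewrite mxtrace_mulC mulmxA (mulmx1C (unitX t)) mul1mx.
  rewrite -(tr0 d h d_gt0 hr) !(mxrepD hr) hA hB 2!mxtraceD trB hornerD hornerC.
  congr (_ + _).
  rewrite horner_sum (eq_bigr (fun s => 1 *: word s)) => [|s _]; last first.
    by rewrite scale1r.
  rewrite (mxrep_sum hr) raddf_sum; apply: eq_bigr => s _; rewrite scale1r.
  by rewrite (h_word _ hr hA hB) -[LHS]/(horner_eval t _) -trace_map_mx.
have := congr1 (fun p : {poly k} => p`_(2 * n.+1)) q0.
rewrite coef0 coefD coefC mulnS /= add0r -mulnS coef_sum => {}q0.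
(* Each pair of a word of length [n.+1] contributes one sign to the coefficient, and shorter words
   have degree below [2 * n.+1]. *)
apply: (mulfI (_ : (-1) ^+ n.+1 != 0)); first by rewrite signr_eq0.
rewrite mulr0 -[RHS]q0 mulr_sumr big_mkcond; apply: eq_big_seq => s ss_s.
have [sz cf] := topmx_tr (wordX_top s); case: eqP => [<-|ne].
  rewrite cf -mxtraceZ; congr (\tr _); elim: {sz cf ss_s} s => [|t s IHs].
    by rewrite !big_nil expr0 scale1r.
  rewrite !big_cons exprS -IHs mulN1r scaleNr.
  by rewrite -[X in _ = X]scalemxAr mulmxN mulNmx scalerN.
rewrite nth_default //; apply: leq_trans sz _.
by have /= := allP hss s ss_s; lia.
Qed.

End Pencil.

(** * Traces of products of weighted cyclic shifts *)

Section CyclicShift.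
Variable k : fieldType.

(** [V] is carried through the product from left to right, and cyclicity brings the last [V] to the
    front. For an empty product the two sides would be the traces of identity matrices of sizes [d]
    and [e]. *)
Lemma mxtrace_sandwich (T : Type) (s : seq T) d e (F G : T -> 'M[k]_d)
    (U : 'M[k]_(d, e)) (V : 'M[k]_(e, d)) : (0 < size s)%N ->
  \tr (\prod_(t <- s) (F t *m (U *m V *m G t *m (U *m V)))) =
  \tr (\prod_(t <- s) (V *m F t *m U *m (V *m G t *m U))).
Proof.
have consE c (H : T -> 'M[k]_c) t s' :
    \prod_(x <- t :: s') H x = H t *m \prod_(x <- s') H x by rewrite big_cons.
have intertwine s' : V *m \prod_(t <- s') (F t *m (U *m V *m G t *m (U *m V))) =
    \prod_(t <- s') (V *m F t *m U *m (V *m G t *m U)) *m V.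
  elim: s' => [|t s' IHs]; first by rewrite !big_nil mulmx1 mul1mx.
  by rewrite !consE -[in RHS](mulmxA _ _ V) -IHs !mulmxA.
case: s => // t s _; rewrite !consE; have := intertwine s.
set L := \prod_(t0 <- s) _; set R := \prod_(t0 <- s) _ => LR.
by rewrite -!mulmxA LR !mulmxA [LHS]mxtrace_mulC !mulmxA.
Qed.

Definition shift_mx n (z : 'I_n.+1 -> k) : 'M[k]_n.+1 :=
  \matrix_(i, j) (z i *+ (j == i + inZp 1)).

Lemma inZpD n i j : inZp i + inZp j = inZp (i + j) :> 'I_n.+1.
Proof. by apply: val_inj; rewrite /= modnDm. Qed.

Lemma prod_shift_mx n (T : Type) (t0 : T) (s : seq T) (z : T -> 'I_n.+1 -> k) i j :
  (\prod_(t <- s) shift_mx (z t)) i j =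
  (\prod_(l < size s) z (nth t0 s l) (i + inZp l)) *+ (j == i + inZp (size s)).
Proof.
elim: s i => [|t s IHs] i.
  rewrite big_nil big_ord0 mxE eq_sym; congr (_ *+ (_ == _)).
  by apply: val_inj; rewrite /= mod0n addn0 modn_small.
have i0 : i + inZp 0 = i.
  by apply: val_inj; rewrite /= mod0n addn0 modn_small.
rewrite big_cons [LHS]mxE (bigD1 (i + inZp 1)) //= [X in _ + X]big1 ?addr0 => [|l li]; last first.
  by rewrite mxE (negbTE li) mul0r.
rewrite mxE eqxx IHs big_ord_recl /= i0 -addrA inZpD add1n mulrnAr.
congr (_ * _ *+ _); apply: eq_bigr => l _.
by rewrite -addrA inZpD add1n.
Qed.

Lemma mxtrace_prod_shift_mx n (T : Type) (t0 : T) (s : seq T)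
    (z : T -> 'I_n.+1 -> k) : size s = n.+1 ->
  \tr (\prod_(t <- s) shift_mx (z t)) =
  \sum_(r < n.+1) \prod_(i < n.+1) z (nth t0 s (i + r)%R) i.
Proof.
(* The diagonal entry at [r] evaluates factor [l] at the index [r + l]; in terms of the index [i]
   this is factor [i - r], hence the change of sign. *)
move=> sz; rewrite (reindex_inj (@oppr_inj _)); apply: eq_bigr => r _.
rewrite (prod_shift_mx t0) sz.
have -> : r + inZp n.+1 = r.
  by apply: val_inj; rewrite /= modnn addn0 modn_small.
rewrite eqxx [RHS](reindex_inj (addrI r)); apply: eq_bigr => i _.
by rewrite valZpK addrAC subrr add0r.
Qed.

End CyclicShift.

(** * The cyclic identity for products of coordinates *)

Section CyclicCoefficients.
Variables (k : fieldType) (A B P : algType k).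
Variables (jA : {lrmorphism A -> P}) (jB : {lrmorphism B -> P}).
Hypothesis k0 : [pchar k] =i pred0.
Hypothesis fp : is_free_product jA jB.

Variables (mA p : nat) (f : A -> 'M[k]_p) (u : 'cV[k]_p).
Variables (phiA : 'M[k]_(mA, p)) (epsA : 'rV[k]_p).
Hypotheses (fr : mxrep f) (phiA_u : phiA *m u = 0) (epsA_u : epsA *m u = 1%:M).
Variables (mB q : nat) (g : B -> 'M[k]_q) (v : 'cV[k]_q).
Variables (phiB : 'M[k]_(mB, q)) (epsB : 'rV[k]_q).
Hypotheses (gr : mxrep g) (phiB_v : phiB *m v = 0) (epsB_v : epsB *m v = 1%:M).

Let cA a j := (phiA *m f a *m u) j 0.
Let cB b j := (phiB *m g b *m v) j 0.

Let row_cA a j : row j phiA *m f a *m u = (cA a j)%:M.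
Proof. by rewrite -!row_mul; apply/rowP => i; rewrite ord1 mxE [RHS]mxE. Qed.
Let row_cB b j : row j phiB *m g b *m v = (cB b j)%:M.
Proof. by rewrite -!row_mul; apply/rowP => i; rewrite ord1 mxE [RHS]mxE. Qed.

Variables (n : nat) (I : 'I_n.+1 -> 'I_mA * 'I_mB).

(* Since phiA u = 0 and phiB v = 0, only the first summand of V contributes to
   V (F a) U, and only the second one to V (G b) U. *)
Let U : 'M[k]_(n.+1 * (p * q), n.+1 * (1 * 1)) := 1%:M *t (u *t v).
Let V : 'M[k]_(n.+1 * (1 * 1), n.+1 * (p * q)) :=
  \sum_l (delta_mx l l *t (row (I l).1 phiA *t epsB) +
          delta_mx l (l + inZp 1) *t (epsA *t row (I l).2 phiB)).

Let F a : 'M[k]_(n.+1 * (p * q)) := 1%:M *t (f a *t 1%:M).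
Let G b : 'M[k]_(n.+1 * (p * q)) := 1%:M *t (1%:M *t g b).

Let VXU (X : 'M[k]_p) (Y : 'M[k]_q) :
  V *m (1%:M *t (X *t Y)) *m U =
  \sum_l (delta_mx l l *t ((row (I l).1 phiA *m X *m u) *t (epsB *m Y *m v)) +
    delta_mx l (l + inZp 1) *t ((epsA *m X *m u) *t (row (I l).2 phiB *m Y *m v))).
Proof.
rewrite !mulmx_suml; apply: eq_bigr => l _.
by rewrite !mulmxDl !tensmx_mul !mulmx1.
Qed.

Let row_u j : row j phiA *m u = 0.
Proof. by rewrite -row_mul phiA_u row0. Qed.
Let row_v j : row j phiB *m v = 0.
Proof. by rewrite -row_mul phiB_v row0. Qed.

Let VU : V *m U = 0.
Proof.
have := VXU 1%:M 1%:M; rewrite !tens_mx11 (mulmx1 V) => ->; rewrite big1 // => l _.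
by rewrite !mulmx1 row_u row_v tens0mx !tensmx0 addr0.
Qed.

(** The scalars arise as tensor factors of size one and are collected in [M]; the identity of size
    [1 * 1] left behind has trace 1. *)
Let tens_scalar11 (M : 'M[k]_n.+1) (a b : k) :
  M *t ((a%:M : 'M_1) *t (b%:M : 'M_1)) = ((a * b) *: M) *t 1%:M.
Proof.
apply/matrixP => i j.
case: (mxtens_indexP i) => i1 i2; case: (mxtens_indexP j) => j1 j2.
case: (mxtens_indexP i2) => i3 i4; case: (mxtens_indexP j2) => j3 j4.
by rewrite !tensmxE !ord1 !mxE !eqxx !mulr1n mulr1 mulrC.
Qed.

Let tens_suml m (M : 'I_n.+1 -> 'M[k]_n.+1) (N : 'M[k]_m) :
  \sum_l (M l *t N) = (\sum_l M l) *t N.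
Proof.
apply/esym/(big_morph (fun X => X *t N)) => [X Y|]; last exact: tens0mx.
by apply/matrixP => i j; rewrite !mxE mulrDl.
Qed.

Let VFU a : V *m F a *m U =
  diag_mx (\row_l cA a (I l).1) *t (1%:M : 'M_(1 * 1)).
Proof.
rewrite VXU diag_mx_sum_delta -tens_suml; apply: eq_bigr => l _.
by rewrite !mulmx1 row_v !tensmx0 addr0 epsB_v row_cA tens_scalar11 mulr1 mxE.
Qed.

Let VGU b : V *m G b *m U =
  shift_mx (fun l => cB b (I l).2) *t (1%:M : 'M_(1 * 1)).
Proof.
have -> : shift_mx (fun l => cB b (I l).2) =
    \sum_l cB b (I l).2 *: delta_mx l (l + inZp 1).
  apply/matrixP => i j; rewrite summxE (bigD1 i) //= big1 ?addr0 => [|l li].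
    by rewrite !mxE eqxx /= mulr_natr.
  by rewrite !mxE eq_sym (negbTE li) mulr0.
rewrite VXU -tens_suml; apply: eq_bigr => l _.
by rewrite !mulmx1 row_u tens0mx tensmx0 add0r epsA_u row_cB tens_scalar11 mul1r.
Qed.

Lemma trace_radical_cyclic a b (ss : seq (seq (A * B))) (t0 : A * B) :
  all (fun s => size s <= n.+1)%N ss ->
  trace_radical P (cclass (jA a + jB b + \sum_(s <- ss) word jA jB s)) ->
  \sum_(s <- ss | size s == n.+1) \sum_(r < n.+1) \prod_(i < n.+1)
     (cA (nth t0 s (i + r)%R).1 (I i).1 * cB (nth t0 s (i + r)%R).2 (I i).2) = 0.
Proof.
move=> hss tr0.
have rank_gt0 m (w : 'cV[k]_m) (eps : 'rV[k]_m) : eps *m w = 1%:M -> (0 < m)%N.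
  case: m w eps => // w eps; rewrite thinmx0 mul0mx => /matrixP/(_ 0 0)/eqP.
  by rewrite !mxE eq_sym oner_eq0.
have dim_gt0 : (0 < n.+1 * (p * q))%N.
  by rewrite !muln_gt0 (rank_gt0 _ _ _ epsA_u) (rank_gt0 _ _ _ epsB_v).
have Fr : mxrep F by apply/mxrep_tensr/mxrep_tensl.
have Gr : mxrep G by apply/mxrep_tensr/mxrep_tensr.
have UVUV : (U *m V) *m (U *m V) = 0.
  by rewrite -mulmxA (mulmxA V) VU mul0mx mulmx0.
rewrite -[RHS](trace_radical_pencil k0 fp dim_gt0 Fr Gr UVUV hss tr0).
apply: eq_bigr => s /eqP sz; rewrite mxtrace_sandwich ?sz //.
rewrite -(mxtrace_prod_shift_mx t0
  (fun t l => cA t.1 (I l).1 * cB t.2 (I l).2)) //.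
(* A diagonal matrix times a weighted shift is a weighted shift whose weights are the products. *)
have -> : \prod_(t <- s) (V *m F t.1 *m U *m (V *m G t.2 *m U)) =
  (\prod_(t <- s) shift_mx (fun l => cA t.1 (I l).1 * cB t.2 (I l).2)) *t
  (1%:M : 'M_(1 * 1)).
  elim: {sz} s => [|t s IHs]; first by rewrite !big_nil tens_mx11.
  rewrite !big_cons IHs VFU VGU !tensmx_mul !mulmx1 -[LHS]/(_ *m _).
  rewrite tensmx_mul mulmx1; congr (_ *t _); rewrite -[RHS]/(_ *m _); congr (_ *m _).
  by rewrite mul_diag_mx; apply/matrixP => i j; rewrite !mxE mulrnAr.
by rewrite mxtrace_tens mxtrace1 mulr1.
Qed.

End CyclicCoefficients.

(** * Descent on word length and splitting of the trace radical *)

Section TraceRadical.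
Variables (k : fieldType) (A B P : algType k).
Variables (jA : {lrmorphism A -> P}) (jB : {lrmorphism B -> P}).
Hypotheses (k0 : [pchar k] =i pred0) (A_rfd : rfd A) (B_rfd : rfd B).
Hypothesis fp : is_free_product jA jB.
Local Notation word := (@word k A B P jA jB).

Lemma word_expand n mA mB (eA : 'I_mA -> A) (eB : 'I_mB -> B)
    (cA : A -> 'I_mA -> k) (cB : B -> 'I_mB -> k) (s : seq (A * B)) t0 :
  size s = n ->
  word [seq (\sum_j cA t.1 j *: eA j, \sum_j cB t.2 j *: eB j) | t <- s] =
  \prod_(i < n) \sum_(q : 'I_mA * 'I_mB)
    (cA (nth t0 s i).1 q.1 * cB (nth t0 s i).2 q.2) *: (jA (eA q.1) * jB (eB q.2)).
Proof.
move=> <-; rewrite /word big_map (big_nth t0) big_mkord; apply: eq_bigr => i _ /=.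
rewrite !linear_sum mulr_suml -(pair_bigA _ (fun j j' =>
  (cA (nth t0 s i).1 j * cB (nth t0 s i).2 j') *: (jA (eA j) * jB (eB j')))) /=.
apply: eq_bigr => j _; rewrite mulr_sumr; apply: eq_bigr => j' _.
by rewrite !linearZ /= -scalerAl -scalerAr scalerA.
Qed.

Lemma trace_radical_shorten n u :
  short_class jA jB n.+1 u -> trace_radical P u -> short_class jA jB n u.
Proof.
move=> [a [b [ss [hss ->]]]] tr0.
have [mA [eA [p [f [x [phiA [epsA [fr phiAx epsAx hA]]]]]]]] :=
  rfd_coordinates A_rfd [seq t.1 | t <- flatten ss].
have [mB [eB [q [g [y [phiB [epsB [gr phiBy epsBy hB]]]]]]]] :=
  rfd_coordinates B_rfd [seq t.2 | t <- flatten ss].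
pose cA a' j := (phiA *m f a' *m x) j 0.
pose cB b' j := (phiB *m g b' *m y) j 0.
pose proj (t : A * B) := (\sum_j cA t.1 j *: eA j, \sum_j cB t.2 j *: eB j).
(* The longest words, with every letter replaced by its coordinate expansion, cancel in the
   cocenter. *)
have top0 : \sum_(s <- ss | size s == n.+1) cclass (word (map proj s)) = 0.
  rewrite -big_filter big_seq.
  pose c (s : seq (A * B)) (i : 'I_n.+1) (r : 'I_mA * 'I_mB) :=
    cA (nth (0, 0) s i).1 r.1 * cB (nth (0, 0) s i).2 r.2.
  rewrite (eq_bigr (fun s => cclass (\prod_i \sum_r
      c s i r *: (jA (eA r.1) * jB (eB r.2))))); last first.
    move=> s; rewrite mem_filter => /andP[/eqP sz _].
    by rewrite (word_expand _ _ _ _ (0, 0) sz).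
  rewrite -big_seq; apply: cyclic_average_eq0 => // I.
  rewrite big_filter; apply: (trace_radical_cyclic k0 fp fr phiAx epsAx
    gr phiBy epsBy I (a := a) (b := b)) => //.
  by rewrite !raddfD raddf_sum.
(* Subtracting this zero sum compares each longest word with its replacement; their letters differ
   by scalars, so the difference is short. *)
have -> : \sum_(s <- ss) cclass (word s) = \sum_(s <- ss | s \in ss) (cclass (word s)
    - if size s == n.+1 then cclass (word (map proj s)) else 0).
  by rewrite -big_seq sumrB -big_mkcond top0 subr0.
apply: short_classD; first apply: short_classD.
- exact: short_class_jA.
- exact: short_class_jB.
apply: short_class_sum => s ss_s; case: eqP => [sz|/eqP ne].
  apply: (@short_class_approx _ _ _ _ jA jB n proj [::] s) => // t ts.
  have ts' : t \in flatten ss by apply/flattenP; exists s.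
  by split; [apply: hA | apply: hB]; apply: map_f.
rewrite subr0; apply: short_class_word.
by have /= := allP hss _ ss_s; rewrite leq_eqVlt (negbTE ne).
Qed.

Lemma free_product_short_class u : exists n, short_class jA jB n u.
Proof.
have [ss E] := free_product_span fp (repr u).
exists (\max_(s <- ss) size s), 0, 0, ss; split.
  by apply/allP => s ss_s; apply: leq_bigmax_seq.
by rewrite -[u]cclassK E !raddf_sum !raddf0 !add0r.
Qed.

Lemma short_class0 u : short_class jA jB 0 u ->
  exists a b, u = cclass (jA a) + cclass (jB b).
Proof.
(* The remaining words are empty, hence equal to 1, and their number is absorbed into [a]. *)
move=> [a [b [ss [hss ->]]]]; exists (a + (size ss)%:R), b.
suff -> : \sum_(s <- ss) cclass (word s) = cclass (jA (size ss)%:R).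
  by rewrite !raddfD addrAC.
elim: ss hss => [|s ss IHs] /=; first by rewrite big_nil !raddf0.
move=> /andP[]; rewrite leqn0 size_eq0 => /eqP -> /IHs {}IHs.
by rewrite big_cons IHs {1}/word big_nil -raddfD /= !rmorph_nat -natr1 addrC.
Qed.

Lemma trace_radical_class u : trace_radical P u ->
  exists a b, u = cclass (jA a) + cclass (jB b).
Proof.
move=> tr0; have [n] := free_product_short_class u.
elim: n => [|n IHn]; first exact: short_class0.
by move/trace_radical_shorten => /(_ tr0).
Qed.

Lemma mxrep_dim_gt0 (C : algType k) n (f : C -> 'M[k]_n) c : f c != 0 -> (0 < n)%N.
Proof. by case: n f => // f; rewrite thinmx0 eqxx. Qed.

Lemma trace_radical_split a b : trace_radical P (cclass (jA a) + cclass (jB b)) ->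
  exists l, trace_radical A (cclass (a - l%:A)) /\
            trace_radical B (cclass (b + l%:A)).
Proof.
rewrite -raddfD => /trace_radicalP tr0.
have tr_tens p q (f : A -> 'M[k]_p) (g : B -> 'M[k]_q) : (0 < p)%N -> (0 < q)%N ->
    mxrep f -> mxrep g -> \tr (f a) * q%:R + p%:R * \tr (g b) = 0.
  move=> p_gt0 q_gt0 fr gr.
  have pq_gt0 : (0 < p * q)%N by rewrite muln_gt0 p_gt0.
  have [h [hr hA hB]] := free_product_mxrep fp pq_gt0
    (mxrep_tensl q fr) (mxrep_tensr p gr).
  rewrite -(tr0 _ _ pq_gt0 hr) (mxrepD hr) hA hB mxtraceD !mxtrace_tens.
  by rewrite !mxtrace1.
have natr_neq0 n : (0 < n)%N -> n%:R != 0 :> k.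
  by rewrite (pcharf0P k).1 // -lt0n.
have [p0 [f0 [f0r /mxrep_dim_gt0 p0_gt0]]] := rfd_mxrep A_rfd (oner_neq0 A).
have [q0 [g0 [g0r /mxrep_dim_gt0 q0_gt0]]] := rfd_mxrep B_rfd (oner_neq0 B).
(* The normalized trace of [a] does not depend on the representation, so its value can be read off
   from the single representation [g0] of [B]. *)
pose l := - \tr (g0 b) / q0%:R; exists l.
have trA p (f : A -> 'M[k]_p) : (0 < p)%N -> mxrep f -> \tr (f a) = l * p%:R.
  move=> p_gt0 fr; apply: (mulIf (natr_neq0 _ q0_gt0)).
  rewrite mulrAC divfK ?natr_neq0 // mulNr [_ * p%:R]mulrC.
  by apply/eqP; rewrite -addr_eq0 tr_tens.
split; apply/trace_radicalP => n f n_gt0 fr.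
  have [_ f1 _] := fr.
  by rewrite (mxrepB fr) (mxrepZ fr) f1 mxtraceD raddfN /= mxtraceZ mxtrace1 trA ?subrr.
have [_ f1 _] := fr; rewrite (mxrepD fr) (mxrepZ fr) f1 mxtraceD mxtraceZ mxtrace1.
apply: (mulfI (natr_neq0 _ p0_gt0)); rewrite mulr0 -(tr_tens _ _ _ _ p0_gt0 n_gt0 f0r fr).
by rewrite trA // mulrDr addrC mulrCA mulrA.
Qed.

Lemma trace_radical_map (C D : algType k) (j : {lrmorphism C -> D}) u :
  trace_radical C u -> trace_radical D (cocenter_map j u).
Proof.
rewrite -[u]cclassK cocenter_mapE => /trace_radicalP tr0.
apply/trace_radicalP => n f n_gt0 fr.
by rewrite -(tr0 _ (f \o j)) //; exact: mxrep_comp.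
Qed.

End TraceRadical.

(** * Injectivity on cocenters and independence of the two images *)

Section Injectivity.
Variables (k : fieldType) (A B P : algType k).
Variables (jA : {lrmorphism A -> P}) (jB : {lrmorphism B -> P}).
Hypotheses (k0 : [pchar k] =i pred0) (B_rfd : rfd B).
Hypothesis fp : is_free_product jA jB.

(** [T] sends the left side to a nonzero multiple of [u] and the right side to a trace of [v], which
    is zero. The case [v = 0] gives injectivity, the general case the trivial intersection. *)
Lemma free_product_cocenter_eq0 u v : trace_radical B v ->
  cocenter_map jA u = cocenter_map jB v -> u = 0.
Proof.
rewrite -[u]cclassK -[v]cclassK !cocenter_mapE => /trace_radicalP tr0 /cclass_eq uv.
have [q [g [gr /mxrep_dim_gt0 q_gt0]]] := rfd_mxrep B_rfd (oner_neq0 B).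
have [T [T0 TA TB]] := free_product_trace fp q_gt0 gr.
have := T0 _ uv; rewrite raddfB /= TA TB (tr0 _ _ q_gt0 gr) scale0r subr0.
by move/eqP; rewrite scaler_eq0 (pcharf0P k).1 // -leqn0 leqNgt q_gt0 => /eqP.
Qed.

Lemma free_product_cocenter_inj : injective (cocenter_map jA).
Proof.
move=> u v uv; apply/eqP; rewrite -subr_eq0; apply/eqP.
apply: (@free_product_cocenter_eq0 _ 0).
  by move=> rho; rewrite raddf0.
by rewrite (raddfB (cocenter_map jA)) (raddf0 (cocenter_map jB)) /= uv subrr.
Qed.

End Injectivity.

Theorem theorem1p2 (k : fieldType) (k_char0 : [pchar k] =i pred0)
    (A B : algType k) (A_rfd : rfd A) (B_rfd : rfd B)
    (P : algType k) (jA : {lrmorphism A -> P}) (jB : {lrmorphism B -> P})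
    (P_free_product : is_free_product jA jB) :
  [/\ injective (cocenter_map jA),
      injective (cocenter_map jB) &
      is_direct_sum (trace_radical P)
        (cocenter_map jA @` trace_radical A)
        (cocenter_map jB @` trace_radical B)].
Proof.
split; first exact: free_product_cocenter_inj P_free_product.
  exact: free_product_cocenter_inj (free_product_swap P_free_product).
split; do ?exact/image_subspace/trace_radical_subspace.
- apply/seteqP; split=> [u tr0|_ [_ [u trA <-] [_ [v trB <-] <-]]].
    have [a [b E]] := trace_radical_class k_char0 A_rfd B_rfd P_free_product tr0.
    move: tr0; rewrite E => /(trace_radical_split k_char0 A_rfd B_rfd P_free_product).
    move=> [l [trA trB]].
    exists (cocenter_map jA (cclass (a - l%:A))); first by exists (cclass (a - l%:A)).
    exists (cocenter_map jB (cclass (b + l%:A))); first by exists (cclass (b + l%:A)).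
    rewrite !cocenter_mapE -!raddfD; congr cclass.
    (* Both homomorphisms preserve 1, so the constants [-l] and [l] cancel in [P]. *)
    rewrite (raddfB jA) (raddfD jB) /= !linearZ /= !rmorph1.
    by rewrite addrACA scalerN addNr addr0.
  move=> rho; rewrite raddfD /=.
  by rewrite (trace_radical_map jA trA rho) (trace_radical_map jB trB rho) addr0.
- apply/seteqP; split=> [_ [[u trA <-] [v trB uv]]|_ ->].
    by rewrite (free_product_cocenter_eq0 k_char0 B_rfd P_free_product trB (esym uv)) raddf0.
  have rad0 C : trace_radical C (0 : cocenter C).
    by have [] := trace_radical_subspace C.
  by split; exists 0; rewrite ?raddf0.
Qed.
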